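(* For every $\lambda\in(0,\infty)$ there exists a constant $C$ such that for every $\varepsilon\in(0,1)$ and all $n$ sufficiently large, with $p=\lambda/n$, the following hold: (lower bound) if $\varepsilon\in(0,\min\{e^{-3\lambda},1\})$ then, for any $\mu>0$, $$t^{\mathrm{RW}}_{\mathrm{mix}}(\varepsilon)\ge\frac1\mu\cdot\frac1{2\lambda}\log(1/\varepsilon);$$ (upper bound) if $\varepsilon\in(0,\tfrac14)$ then, whenever $0<\mu\le\tfrac23(1+\lambda)^{-1}/n$, $$t^{\mathrm{RW}}_{\mathrm{mix}}(\varepsilon)\le\frac1\mu\cdot C\log(1/\varepsilon).$$
   Context: Model (dynamical percolation on the complete graph with a random walk). Let $V=\{1,\dots,n\}$ and let $E$ be the edge set of the complete graph on $V$. Given $p\in[0,1]$ and $\mu>0$, the environment $(\eta_t)_{t\ge0}$ takes values in $\{0,1\}^E$ ($1$ = open, $0$ = closed): each edge independently refreshes at rate $\mu$ and, upon refreshing, is declared open with probability $p$ and closed with probability $1-p$. The walker $X_t\in V$ has a rate-$1$ exponential clock; when it rings, the walker chooses uniformly at random one of the $n-1$ other vertices $v$, and moves from its current location $x$ to $v$ if the edge between $x$ and $v$ is open at that time, otherwise it stays put. $\mathbb{P}_{x_0,\eta_0}$ is the law of $(X_t,\eta_t)_{t\ge0}$ started from $(x_0,\eta_0)\in V\times\{0,1\}^E$. Let $\pi_U$ be the uniform distribution on $V$ and $\pi_{\mathrm{ER}}$ the product measure on $\{0,1\}^E$ in which each edge is open with probability $p$. Write $\mathbb{P}_{1,\mathrm{ER}}(\cdot)=\sum_{\eta_0}\mathbb{P}_{1,\eta_0}(\cdot)\,\pi_{\mathrm{ER}}(\eta_0)$,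 i.e. the walk starts from vertex $1$ and the initial environment is drawn from $\pi_{\mathrm{ER}}$. Here $t^{\mathrm{RW}}_{\mathrm{mix}}(\varepsilon)=\sup\{t\ge0 : \|\mathbb{P}_{1,\mathrm{ER}}(X_t\in\cdot)-\pi_U\|_{\mathrm{TV}}\ge\varepsilon\}$, where $\|\cdot\|_{\mathrm{TV}}$ is total variation distance. *)

(* Defs.v *)
From HB Require Import structures.
From mathcomp Require Import all_boot all_order all_algebra.
From mathcomp Require Import all_classical all_reals all_analysis.

Set Implicit Arguments.
Unset Strict Implicit.
Unset Printing Implicit Defensive.

Import Order.TTheory GRing.Theory Num.Theory.
Import numFieldNormedType.Exports.

Local Open Scope ring_scope.

Definition edge (n : nat) : finType := {e : {set 'I_n} | #|e| == 2%N}.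

Definition env (n : nat) : finType := {ffun edge n -> bool}.

Definition state (n : nat) : finType := ('I_n * env n)%type.

Definition is_open (n : nat) (eta : env n) (x v : 'I_n) : bool :=
  [exists e : edge n, (val e == [set x; v]) && eta e].

Definition set_edge (n : nat) (eta : env n) (e : edge n) (b : bool) : env n :=
  [ffun e' => if e' == e then b else eta e'].

(* Infinitesimal generator of the Markov chain (X_t, eta_t): the walker rings
   at rate 1 and each edge refreshes at rate mu, all independently. *)
Definition generator (R : realType) (n : nat) (p mu : R)
    (f : state n -> R) (s : state n) : R :=
  let: (x, eta) := s in
  \sum_(v : 'I_n | v != x)
     (n.-1)%:R^-1 * (f (if is_open eta x v then v else x, eta) - f (x, eta))
  + \sum_(e : edge n)
     mu * (p * (f (x, set_edge eta e true) - f (x, eta))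
           + (1 - p) * (f (x, set_edge eta e false) - f (x, eta))).

(* exp (t L) = \sum_k t^k / k! L^k, for a bounded operator L on functions on a
   finite set. When L is the generator of a Markov chain (Z_t),
   (semigroup L t f) s is the expectation of f (Z_t) given Z_0 = s. *)
Definition semigroup (R : realType) (S : finType)
    (L : (S -> R) -> (S -> R)) (t : R) (f : S -> R) (s : S) : R :=
  limn (series (fun k : nat => t ^+ k / k`!%:R * iter k L f s)).

(* P_{x0, eta0} ((X_t, eta_t) \in A) *)
Definition law (R : realType) (n : nat) (p mu : R)
    (x0 : 'I_n) (eta0 : env n) (t : R) (A : {set state n}) : R :=
  semigroup (generator p mu) t (fun s => (s \in A)%:R) (x0, eta0).

Definition pi_U (R : realType) (n : nat) (A : {set 'I_n}) : R :=
  #|A|%:R / n%:R.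

Definition pi_ER (R : realType) (n : nat) (p : R) (eta : env n) : R :=
  \prod_(e : edge n) (if eta e then p else 1 - p).

(* P_{x0, ER} (X_t \in A) *)
Definition law_ER (R : realType) (n : nat) (p mu : R)
    (x0 : 'I_n) (t : R) (A : {set 'I_n}) : R :=
  \sum_(eta0 : env n)
     law p mu x0 eta0 t [set s : state n | s.1 \in A] * pi_ER p eta0.

Definition TV (R : realType) (T : finType) (P Q : {set T} -> R) : R :=
  \big[Num.max/0]_(A : {set T}) `|P A - Q A|.

(* The supremum is taken in \bar R, so that it is +oo if the set of times is
   unbounded. The set contains t = 0 as soon as eps <= 1 - 1 / n; otherwise it
   may be empty, and then the value is -oo. *)
Definition tmix_RW (R : realType) (n : nat) (p mu : R) (x0 : 'I_n) (eps : R) :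
    \bar R :=
  ereal_sup [set t%:E | t in
    [set t : R | 0 <= t /\ eps <= TV (law_ER p mu x0 t) (@pi_U R n)]]%classic.

(* Main.v *)
(** Upper bound: the joint chain of walk and environment is reversible for
    [uniform * ER], and satisfies the Poincare inequality
      [Var f <= (1 + 3 / lambda) / mu * E(f, f)] when [mu * n <= 1].
    For a fixed position of the walker the variance over the environment is
    bounded by the refresh part of [E] (Efron-Stein).  For the variance over the
    position, the means of [f (x, _)] and [f (y, _)] are compared through the
    event that the edge [xy] is open, of probability [p = lambda / n]: on it the
    walker may cross [xy], which is the walk part of [E], and conditioning on it
    moves each mean by at most the influence of the edge [xy].
    Started from [f = 1_{x = 1}], whose variance is about [1 / n], the decay of
    [||e^{tL} f - 1 / n||] gives
      [P(X_t = 1) - 1 / n <= exp (- mu t / (1 + 3 / lambda))],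
    and since the vertices other than [1] are exchangeable, the left-hand side
    is the total variation distance.

    Lower bound: with probability about [exp (- lambda - lambda mu t)] all the
    edges at vertex [1] are closed during the whole of [[0, t]]. *)
Require Import Defs.
From HB Require Import structures.
From mathcomp Require Import all_boot all_order all_algebra.
From mathcomp Require Import all_classical all_reals all_analysis.
From mathcomp Require Import perm ring lra.
Set Implicit Arguments.
Unset Strict Implicit.
Unset Printing Implicit Defensive.
Import Order.TTheory GRing.Theory Num.Theory.
Import numFieldNormedType.Exports.
Local Open Scope ring_scope.

(** * Differentiation rules on the real line and Gronwall's inequality *)

Section Calculus.
Variable R : realType.

Lemma is_derive_sum_fun (I : Type) (r : seq I) (F : I -> R -> R) (dF : I -> R)
    (x : R) :
  (forall i, is_derive x 1 (F i) (dF i)) ->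
  is_derive x 1 (fun t => \sum_(i <- r) F i t) (\sum_(i <- r) dF i).
Proof.
move=> dFi; elim: r => [|i r IHr].
  rewrite big_nil (_ : (fun _ => _) = cst 0); first exact: is_derive_cst.
  by apply/funext => t; rewrite big_nil.
rewrite big_cons (_ : (fun _ => _) = F i + (fun t => \sum_(j <- r) F j t)).
  exact: is_deriveD.
by apply/funext => t; rewrite big_cons.
Qed.

Lemma is_derive_mul_fun (f g : R -> R) (df dg x : R) :
  is_derive x 1 f df -> is_derive x 1 g dg ->
  is_derive x 1 (fun t => f t * g t) (f x * dg + g x * df).
Proof. by move=> fx gx; exact: is_deriveM. Qed.

Lemma is_derive_scale_fun (c : R) (f : R -> R) (df x : R) :
  is_derive x 1 f df -> is_derive x 1 (fun t => c * f t) (c * df).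
Proof. by move=> fx; exact: is_deriveZ. Qed.

Lemma is_derive_expR_scale (k x : R) :
  is_derive x 1 (fun t => expR (k * t)) (k * expR (k * x)).
Proof.
have kx : is_derive x 1 (fun t : R => k * t) k.
  rewrite -{2}(mulr1 k).
  exact: (@is_derive_scale_fun k id).
rewrite mulrC.
exact: (@is_derive1_comp _ expR (fun t => k * t) _ _ _ (is_derive_expR _) kx).
Qed.

(** The product [phi x * expR (- k * x)] has nonpositive derivative. The sign of [k] is free: a
    nonnegative [k] serves for uniqueness in linear systems, a negative one for exponential decay of
    the variance. *)
Lemma gronwall (phi dphi : R -> R) (k t : R) :
  (forall x : R, is_derive x 1 phi (dphi x)) ->
  (forall x, dphi x <= k * phi x) -> 0 <= t ->
  phi t <= phi 0 * expR (k * t).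
Proof.
move=> dphiP le_dphi t_ge0.
pose psi x := phi x * expR (- k * x).
have dpsi (x : R) : is_derive x 1 psi (phi x * (- k * expR (- k * x))
                                 + expR (- k * x) * dphi x).
  exact: is_derive_mul_fun (dphiP x) (is_derive_expR_scale _ _).
have psi_der (x : R) : derivable psi x 1 by have [] := dpsi x.
have : psi t <= psi 0.
  apply: (@ler0_derive1_nincr _ psi 0 t) => // [x _|].
    rewrite derive1E (@derive_val _ _ _ _ _ _ _ (dpsi x)).
    have := le_dphi x; have := expR_ge0 (- k * x); nra.
  apply: derivable_within_continuous => x _; exact: psi_der.
rewrite /psi mulr0 expR0 mulr1 => le_psi.
rewrite -(ler_pM2r (expR_gt0 (- k * t))) -mulrA -expRD.
by rewrite mulNr subrr expR0 mulr1 -mulNr.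
Qed.

End Calculus.

(** * The exponential of a matrix indexed by a finite set *)

Section KernelSemigroup.
Variables (R : realType) (S : finType).
Implicit Types (a : S -> S -> R) (f g : S -> R).

Definition kernel_op a f (s : S) : R := \sum_(s' : S) a s s' * f s'.

Definition kernel_norm a : R := \sum_(s : S) \sum_(s' : S) `|a s s'|.

Lemma kernel_norm_ge0 a : 0 <= kernel_norm a.
Proof. by do 2!apply: sumr_ge0 => ? _. Qed.

Lemma sum_norm_iter_kernel_op a f k :
  \sum_s `|iter k (kernel_op a) f s| <= kernel_norm a ^+ k * \sum_s `|f s|.
Proof.
elim: k => [|k IHk]; first by rewrite mul1r.
rewrite exprS -mulrA; apply: le_trans (ler_wpM2l (kernel_norm_ge0 a) IHk).
rewrite /kernel_norm mulr_suml; apply: ler_sum => s _ /=.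
apply: le_trans (ler_norm_sum _ _ _) _.
rewrite mulr_suml; apply: ler_sum => s' _; rewrite normrM ler_wpM2l//.
by rewrite (bigD1 s')//= lerDl sumr_ge0.
Qed.

Lemma norm_iter_kernel_op a f k s :
  `|iter k (kernel_op a) f s| <= kernel_norm a ^+ k * \sum_s `|f s|.
Proof.
apply: le_trans (sum_norm_iter_kernel_op a f k).
by rewrite [leRHS](bigD1 s)//= lerDl sumr_ge0.
Qed.

Let term a f s (t : R) (k : nat) : R :=
  t ^+ k / k`!%:R * iter k (kernel_op a) f s.

(** Domination by the exponential series of [|t| * kernel_norm a]. The limit in [semigroup] is
    meaningful only once convergence is known. *)
Lemma cvg_series_semigroup a f s t :
  (series (term a f s t) @ \oo --> semigroup (kernel_op a) t f s)%classic.
Proof.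
suff /cvg_ex[l cvgl] : cvgn (series (term a f s t)).
  by rewrite /semigroup -/(term a f s t) (cvg_lim _ cvgl).
apply: normed_cvg.
have cvgE : cvgn (series ((\sum_s `|f s|) *:
    exp_coeff (`|t| * kernel_norm a))).
  by apply: is_cvg_seriesZ; exact: is_cvg_series_exp_coeff.
apply: (series_le_cvg _ _ _ cvgE) => k; first exact: normr_ge0.
  rewrite /= mulr_ge0 ?sumr_ge0//.
  by rewrite exp_coeff_ge0// mulr_ge0// kernel_norm_ge0.
rewrite /term /= normrM normrM normfV normrX (ger0_norm (ler0n _ _)).
rewrite -[leRHS]/(_ * exp_coeff (`|t| * kernel_norm a) k) exp_coeffE exprMn.
rewrite mulrC; apply: le_trans (ler_wpM2r _ (norm_iter_kernel_op a f k s)) _.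
  by rewrite mulr_ge0 ?invr_ge0 ?exprn_ge0.
by rewrite le_eqVlt; apply/orP; left; apply/eqP; ring.
Qed.

Lemma semigroup0 a f s : semigroup (kernel_op a) 0 f s = f s.
Proof.
apply: cvg_lim => //; rewrite -cvg_shiftS.
rewrite (_ : (fun _ => _) = cst (f s)); first exact: cvg_cst.
apply/funext => k; rewrite /series /= big_nat_recl//= fact0 invr1 !mul1r.
by rewrite big1 ?addr0// => i _; rewrite exprS !mul0r.
Qed.

Lemma kernel_op_semigroup a f t s :
  kernel_op a (semigroup (kernel_op a) t f) s =
  semigroup (kernel_op a) t (kernel_op a f) s.
Proof.
apply/esym/cvg_lim => //.
rewrite (_ : series _ = fun k => \sum_s' a s s' * series (term a f s' t) k).
  rewrite [X in (_ --> X)%classic]/kernel_op.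
  elim: (index_enum S) => [|s' r IHr].
    under eq_fun do rewrite big_nil.
    by rewrite big_nil; exact: cvg_cst.
  under eq_fun do rewrite big_cons.
  rewrite big_cons; apply: cvgD; last exact: IHr.
  exact: (cvgMl_tmp (cvg_series_semigroup (a := a) (f := f) (s := s') (t := t))).
apply/funext => k; rewrite /series /=.
under [RHS]eq_bigr do rewrite mulr_sumr.
rewrite [RHS]exchange_big/=; apply: eq_bigr => i _.
rewrite -iterSr /= [kernel_op a _ s]/kernel_op mulr_sumr.
by apply: eq_bigr => s' _; rewrite /term mulrCA.
Qed.

(** Termwise differentiation of the power series in [t]: shifting the coefficients replaces [f] by
    [kernel_op a f], and [kernel_op_semigroup] moves the operator outside. *)
Lemma is_derive_semigroup a f s (t : R) :
  is_derive t 1 (fun t => semigroup (kernel_op a) t f s)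
    (kernel_op a (semigroup (kernel_op a) t f) s).
Proof.
pose c g (k : nat) := iter k (kernel_op a) g s / k`!%:R.
have cE g x : pseries (c g) x = series (term a g s x).
  apply/funext => k; rewrite /pseries /series /=; apply: eq_bigr => i _.
  by rewrite /c /term; ring.
have cS g : pseries_diffs (c g) = c (kernel_op a g).
  apply/funext => k; rewrite /pseries_diffs /c -iterSr factS natrM.
  by rewrite invfM mulrCA mulVKf ?pnatr_eq0.
have cvgc g x : cvgn (pseries (c g) x).
  by rewrite cE; apply/cvg_ex; eexists; exact: cvg_series_semigroup.
rewrite kernel_op_semigroup.
rewrite (_ : (fun _ => _) = (fun x => limn (pseries (c f) x))); last first.
  by apply/funext => x; rewrite cE.
rewrite /semigroup -/(term a (kernel_op a f) s t) -cE -cS.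
apply: (@pseries_snd_diffs _ _ (`|t| + 1)); rewrite ?cS//.
by rewrite [ltRHS]ger0_norm// ltrDl.
Qed.

(** Gronwall for the sum of squares [phi], which starts at zero. The effect of the semigroup on
    constants and sums, and of a diagonal shift, is derived from this uniqueness instead of from the
    series. *)
Lemma kernel_ode_unique a (w : R -> S -> R) t :
  (forall s (x : R), is_derive x 1 (w ^~ s) (kernel_op a (w x) s)) ->
  (forall s, w 0 s = 0) -> 0 <= t -> forall s, w t s = 0.
Proof.
move=> dw w0 t_ge0.
pose phi x := \sum_s w x s * w x s.
pose dphi x := \sum_s (w x s * kernel_op a (w x) s
                       + w x s * kernel_op a (w x) s).
have phi_ge x s : w x s ^+ 2 <= phi x.
  rewrite /phi (bigD1 s)//= -expr2 lerDl sumr_ge0// => s' _.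
  by rewrite -expr2 sqr_ge0.
have dphiP (x : R) : is_derive x 1 phi (dphi x).
  by apply: is_derive_sum_fun => s; exact: is_derive_mul_fun.
have dphi_le x : dphi x <= (2 * kernel_norm a) * phi x.
  have -> : 2 * kernel_norm a * phi x =
      \sum_s (2 * \sum_s' (`|a s s'| * phi x)).
    rewrite -mulr_sumr -mulrA; congr (_ * _); rewrite [LHS]mulr_suml.
    by apply: eq_bigr => s _; rewrite mulr_suml.
  apply: ler_sum => s _; rewrite -mulr2n -[leLHS]mulr_natl ler_pM2l//.
  rewrite [leLHS]mulr_sumr.
  (* Each product [w x s * w x s'] is at most [phi x] in absolute value, because both squares
     are. *)
  apply: ler_sum => s' _; rewrite mulrCA.
  apply: le_trans (ler_norm _) _; rewrite normrM ler_wpM2l// ler_norml.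
  have := phi_ge x s; have := phi_ge x s'; rewrite !expr2 => le1 le2.
  have := sqr_ge0 (w x s - w x s'); have := sqr_ge0 (w x s + w x s').
  by rewrite !expr2 => le3 le4; apply/andP; split; nra.
move=> s; apply/eqP; rewrite -sqrf_eq0 eq_le sqr_ge0 andbT.
apply: le_trans (phi_ge t s) _.
have := gronwall dphiP dphi_le t_ge0.
by rewrite {2}/phi big1 ?mul0r// => s' _; rewrite w0 mul0r.
Qed.

Lemma semigroup_cst a (c t : R) s :
  (forall s, kernel_op a (fun=> c) s = 0) -> 0 <= t ->
  semigroup (kernel_op a) t (fun=> c) s = c.
Proof.
move=> ac0 t_ge0; apply/eqP; rewrite -subr_eq0; apply/eqP.
pose w x s := semigroup (kernel_op a) x (fun=> c) s - c.
apply: (@kernel_ode_unique a w) => // [{}s x|{}s]; last first.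
  by rewrite /w semigroup0 subrr.
apply: is_derive_eq.
  exact: is_deriveB (is_derive_semigroup a (fun=> c) s x) (is_derive_cst _ _ _).
rewrite subr0 /w -[RHS]addr0 -(ac0 s) /kernel_op -big_split.
by apply: eq_bigr => s' _ /=; rewrite -mulrDr subrK.
Qed.

Lemma semigroup_sum a (I : Type) (r : seq I) (P : pred I) (F : I -> S -> R) t s :
  0 <= t ->
  semigroup (kernel_op a) t (fun s => \sum_(i <- r | P i) F i s) s =
  \sum_(i <- r | P i) semigroup (kernel_op a) t (F i) s.
Proof.
move=> t_ge0; rewrite -[RHS]big_filter.
under [in LHS]eq_fun do rewrite -big_filter.
apply/eqP; rewrite -subr_eq0; apply/eqP; move: {r P} [seq _ <- _ | _] => r.
pose w x s := semigroup (kernel_op a) x (fun s => \sum_(i <- r) F i s) s -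
  \sum_(i <- r) semigroup (kernel_op a) x (F i) s.
apply: (@kernel_ode_unique a w) => // [{}s x|{}s]; last first.
  rewrite /w semigroup0; under [X in _ - X]eq_bigr do rewrite semigroup0.
  by rewrite subrr.
apply: is_derive_eq.
  exact: is_deriveB (is_derive_semigroup a _ s x)
    (is_derive_sum_fun r (fun i => is_derive_semigroup a (F i) s x)).
rewrite /w [in RHS]/kernel_op; under [RHS]eq_bigr do rewrite mulrBr mulr_sumr.
by rewrite sumrB [X in _ = _ - X]exchange_big.
Qed.

Definition shift_kernel a (m : R) s s' : R := a s s' + m * (s' == s)%:R.

Lemma kernel_op_shift a m f s :
  kernel_op (shift_kernel a m) f s = kernel_op a f s + m * f s.
Proof.
rewrite /kernel_op /shift_kernel; under eq_bigr do rewrite mulrDl.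
rewrite big_split /=; congr (_ + _).
rewrite (bigD1 s)//= eqxx mulr1 big1 ?addr0// => s' /negPf ->.
by rewrite mulr0 mul0r.
Qed.

Lemma semigroup_shift a m f t s : 0 <= t ->
  semigroup (kernel_op (shift_kernel a m)) t f s =
  expR (m * t) * semigroup (kernel_op a) t f s.
Proof.
move=> t_ge0; apply/eqP; rewrite -subr_eq0; apply/eqP.
pose w x s := semigroup (kernel_op (shift_kernel a m)) x f s
              - expR (m * x) * semigroup (kernel_op a) x f s.
apply: (@kernel_ode_unique (shift_kernel a m) w) => // {t_ge0 t}s; last first.
  by rewrite /w !semigroup0 mulr0 expR0 mul1r subrr.
move=> x; apply: is_derive_eq.
  exact: is_deriveB (is_derive_semigroup (shift_kernel a m) f s x)
    (is_derive_mul_fun (is_derive_expR_scale m x)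
                       (is_derive_semigroup a f s x)).
rewrite !kernel_op_shift /w /kernel_op.
under [in RHS]eq_bigr do rewrite mulrBr mulrCA.
by rewrite sumrB -mulr_sumr; ring.
Qed.

(* The off-diagonal entries of [a] are nonnegative, so that [a + m] has
   nonnegative entries for [m] large, and [e^{ta} = e^{-mt} e^{t(a + m)}] is a
   series of positive operators. *)
Lemma semigroup_ge a f g (c t : R) s :
  (forall s s', s != s' -> 0 <= a s s') ->
  (forall s, 0 <= g s) -> (forall s, g s <= f s) ->
  (forall s, - c * g s <= kernel_op a g s) -> 0 <= t ->
  expR (- c * t) * g s <= semigroup (kernel_op a) t f s.
Proof.
move=> a_ge0 g_ge0 le_gf le_ag t_ge0.
(* The first summand of [m] makes the diagonal of [K] nonnegative, the second gives [m >= c]; thus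
   [(a + m) g >= (m - c) g] can be iterated. *)
pose m := kernel_norm a + `|c|; pose K := shift_kernel a m.
have m_gec : 0 <= m - c.
  by have := kernel_norm_ge0 a; have := ler_norm c; rewrite /m; lra.
have K_ge0 s1 s2 : 0 <= K s1 s2.
  rewrite /K /shift_kernel; have [->|ne12] := eqVneq s2 s1; last first.
    by rewrite mulr0 addr0 a_ge0// eq_sym.
  have : `|a s1 s1| <= kernel_norm a.
    rewrite /kernel_norm (bigD1 s1)//= (bigD1 s1)//= -addrA lerDl addr_ge0//.
      by rewrite sumr_ge0.
    by apply: sumr_ge0 => ? _; rewrite sumr_ge0.
  have := ler_norm (- a s1 s1); rewrite normrN /= mulr1 /m.
  by have := normr_ge0 c; lra.
have iter_ge k s1 : (m - c) ^+ k * g s1 <= iter k (kernel_op K) f s1.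
  elim: k s1 => [|k IHk] s1; first by rewrite mul1r.
  rewrite /=; apply: (@le_trans _ _ (kernel_op K (fun s => (m - c) ^+ k * g s) s1)).
    rewrite kernel_op_shift /kernel_op.
    under eq_bigr do rewrite mulrCA.
    rewrite -mulr_sumr exprS.
    have := le_ag s1; have := exprn_ge0 k m_gec; rewrite /kernel_op; nra.
  by apply: ler_sum => s' _; rewrite ler_wpM2l.
(* Termwise comparison with the exponential series; the factor [expR (m * t)] of the shifted
   semigroup cancels afterwards. *)
have : expR ((m - c) * t) * g s <= semigroup (kernel_op K) t f s.
  have cvgE : (series (exp_coeff ((m - c) * t) : R^nat) n * g s @[n --> \oo] -->
      expR ((m - c) * t) * g s)%classic.
    exact: (cvgMr_tmp (@is_cvg_series_exp_coeff _ ((m - c) * t))).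
  have cvgK := cvg_series_semigroup (a := K) (f := f) (s := s) (t := t).
  rewrite -(cvg_lim _ cvgE)// -(cvg_lim _ cvgK)//.
  apply: ler_lim.
  - by apply/cvg_ex; eexists; exact: cvgE.
  - by apply/cvg_ex; eexists; exact: cvgK.
  apply: nearW => n; rewrite /series /= mulr_suml; apply: ler_sum => k _.
  rewrite /exp_coeff /= exprMn /term.
  have := iter_ge k s.
  have t_pos : 0 <= t ^+ k / k`!%:R by rewrite divr_ge0 ?exprn_ge0.
  move=> /(ler_wpM2l t_pos); apply: le_trans.
  by rewrite le_eqVlt; apply/orP; left; apply/eqP; ring.
rewrite semigroup_shift// mulrBl -mulNr expRD -mulrA.
by rewrite ler_pM2l ?expR_gt0.
Qed.

End KernelSemigroup.

(** Lagrange's identity: twice the difference of the two sides is the double sum of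
    [w i * w j * (f i * g j - f j * g i) ^+ 2]. *)
Lemma cauchy_schwarz_sum (R : realDomainType) (I : finType) (w f g : I -> R) :
  (forall i, 0 <= w i) ->
  (\sum_i w i * (f i * g i)) ^+ 2 <=
  (\sum_i w i * f i ^+ 2) * (\sum_i w i * g i ^+ 2).
Proof.
move=> w_ge0.
set A := \sum_i w i * f i ^+ 2; set B := \sum_i w i * g i ^+ 2.
set C := \sum_i _.
suff : 0 <= A * B + B * A - 2 * (C * C) by rewrite expr2; lra.
rewrite /A /B /C !big_distrlr /= mulr_sumr -big_split -sumrB /=.
apply: sumr_ge0 => i _; rewrite mulr_sumr -big_split -sumrB /=.
apply: sumr_ge0 => j _.
rewrite (_ : _ - _ = w i * w j * (f i * g j - f j * g i) ^+ 2); last by ring.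
by rewrite mulr_ge0 ?sqr_ge0 ?mulr_ge0.
Qed.

(** * Environments under changes of a single edge *)

Section SetEdge.
Variable n : nat.
Implicit Types (eta : env n) (e : edge n) (b : bool).

Lemma set_edgeE eta e b e' :
  set_edge eta e b e' = if e' == e then b else eta e'.
Proof. by rewrite ffunE. Qed.

Lemma set_edge_set eta e b c : set_edge (set_edge eta e b) e c = set_edge eta e c.
Proof. by apply/ffunP => e'; rewrite !set_edgeE; case: eqP. Qed.

Lemma set_edge_id eta e : set_edge eta e (eta e) = eta.
Proof. by apply/ffunP => e'; rewrite !set_edgeE; case: eqP => [->|]. Qed.

Lemma set_edgeC eta e e' b b' : e != e' ->
  set_edge (set_edge eta e b) e' b' = set_edge (set_edge eta e' b') e b.
Proof.
move=> ee'; apply/ffunP => e1; rewrite !set_edgeE.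
by case: (eqVneq e1 e') => // ->; rewrite eq_sym (negPf ee').
Qed.

(** Setting the edges one after the other turns [eta] into [eta']. *)
Lemma set_edge_invariant_cst (T : Type) (k : env n -> T) :
  (forall e eta b, k (set_edge eta e b) = k eta) ->
  forall eta eta', k eta = k eta'.
Proof.
move=> k_inv eta eta'.
pose h s := foldr (fun e z => set_edge z e (eta' e)) eta s.
have hE s e : h s e = if e \in s then eta' e else eta e.
  elim: s => //= e1 s IHs; rewrite set_edgeE in_cons IHs.
  by case: eqVneq => // ->.
have <- : h (enum [set: edge n]) = eta'.
  by apply/ffunP => e; rewrite hE mem_enum inE.
by elim: (enum _) => //= e s ->; rewrite k_inv.
Qed.

(** Environments that agree off [e] are paired, the member with [e] open standing for the pair;
    identities about resampling [e] become two-point computations. *)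
Lemma sum_env_split (R : zmodType) (F : env n -> R) e :
  \sum_(eta : env n) F eta =
  \sum_(eta : env n | eta e) (F eta + F (set_edge eta e false)).
Proof.
rewrite (bigID (fun eta : env n => eta e)) /= big_split /=; congr (_ + _).
rewrite (reindex_onto (fun eta : env n => set_edge eta e false)
                      (fun eta : env n => set_edge eta e true)) /=; last first.
  by move=> eta /negPf etaF; rewrite set_edge_set -etaF set_edge_id.
apply: eq_bigl => eta; rewrite set_edgeE eqxx /= set_edge_set.
apply/eqP/idP => [<-|etaT]; first by rewrite set_edgeE eqxx.
by rewrite -etaT set_edge_id.
Qed.

End SetEdge.

(** * The product measure on environments, resampling and variances *)

Section Environment.
Variables (R : realType) (n : nat) (p : R).
Hypotheses (p_ge0 : 0 <= p) (p_le1 : p <= 1).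
Implicit Types (eta : env n) (e : edge n) (b : bool) (g h k : env n -> R).

Definition meanER g : R := \sum_(eta : env n) pi_ER p eta * g eta.

(** Conditional expectation given the edges other than [e], hence an orthogonal projection in L^2 of
    [pi_ER]. *)
Definition resample e g eta : R :=
  p * g (set_edge eta e true) + (1 - p) * g (set_edge eta e false).

(** The expected conditional variance along [e], that is, the influence of [e] on [g]. *)
Definition edge_var e g : R := meanER (fun eta => (g eta - resample e g eta) ^+ 2).

Lemma pi_ER_ge0 eta : 0 <= pi_ER p eta.
Proof. by apply: prodr_ge0 => e _; case: ifP => _ //; rewrite subr_ge0. Qed.

Lemma meanER_prod (F : edge n -> bool -> R) :
  meanER (fun eta => \prod_e F e (eta e)) =
  \prod_e (p * F e true + (1 - p) * F e false).
Proof.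
transitivity (\prod_e \sum_b (if b then p else 1 - p) * F e b).
  rewrite bigA_distr_bigA /=; apply: eq_bigr => eta _.
  by rewrite /pi_ER -big_split.
by apply: eq_bigr => e _; rewrite big_bool.
Qed.

Lemma meanER_cst (c : R) : meanER (fun=> c) = c.
Proof.
rewrite /meanER -mulr_suml.
suff -> : \sum_(eta : env n) pi_ER p eta = 1 by rewrite mul1r.
transitivity (\prod_(e : edge n) (p * 1 + (1 - p) * 1)); last first.
  by apply: big1 => e _; rewrite !mulr1 addrC subrK.
rewrite -(meanER_prod (fun _ _ => 1)) /meanER.
by apply: eq_bigr => eta _; rewrite big1_eq mulr1.
Qed.

Lemma eq_meanER g h : g =1 h -> meanER g = meanER h.
Proof. by move=> gh; apply: eq_bigr => eta _; rewrite gh. Qed.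

Lemma meanERD g h : meanER (fun eta => g eta + h eta) = meanER g + meanER h.
Proof. by rewrite /meanER -big_split; apply: eq_bigr => eta _; rewrite mulrDr. Qed.

Lemma meanERB g h : meanER (fun eta => g eta - h eta) = meanER g - meanER h.
Proof. by rewrite /meanER -sumrB; apply: eq_bigr => eta _; rewrite mulrBr. Qed.

Lemma meanERZ c g : meanER (fun eta => c * g eta) = c * meanER g.
Proof. by rewrite /meanER mulr_sumr; apply: eq_bigr => eta _; rewrite mulrCA. Qed.

Lemma meanER_sum (I : Type) (r : seq I) (P : pred I) (F : I -> env n -> R) :
  meanER (fun eta => \sum_(i <- r | P i) F i eta) =
  \sum_(i <- r | P i) meanER (F i).
Proof.
rewrite /meanER exchange_big; apply: eq_bigr => eta _; exact: mulr_sumr.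
Qed.

Lemma meanER_ge0 g : (forall eta, 0 <= g eta) -> 0 <= meanER g.
Proof. by move=> g_ge0; apply: sumr_ge0 => eta _; rewrite mulr_ge0 ?pi_ER_ge0. Qed.

Lemma ler_meanER g h : (forall eta, g eta <= h eta) -> meanER g <= meanER h.
Proof. by move=> gh; apply: ler_sum => eta _; rewrite ler_wpM2l ?pi_ER_ge0. Qed.

Lemma cauchy_schwarz_meanER g h :
  meanER (fun eta => g eta * h eta) ^+ 2 <=
  meanER (fun eta => g eta ^+ 2) * meanER (fun eta => h eta ^+ 2).
Proof. exact/cauchy_schwarz_sum/pi_ER_ge0. Qed.

Lemma edge_var_ge0 e g : 0 <= edge_var e g.
Proof. by apply: meanER_ge0 => eta; rewrite sqr_ge0. Qed.

Lemma resample_set e g eta b : resample e g (set_edge eta e b) = resample e g eta.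
Proof. by rewrite /resample !set_edge_set. Qed.

Lemma resampleC e e' g : resample e (resample e' g) =1 resample e' (resample e g).
Proof.
move=> eta; have [->//|ee'] := eqVneq e e'.
have swap b b' := set_edgeC eta b b' ee'.
rewrite /resample; move: (@set_edge n) swap => sete swap.
by rewrite !swap; ring.
Qed.

Lemma resampleB e g h :
  resample e (fun eta => g eta - h eta) =1
  (fun eta => resample e g eta - resample e h eta).
Proof. by move=> eta; rewrite /resample; ring. Qed.

Lemma resample_mulr e g h : (forall eta b, h (set_edge eta e b) = h eta) ->
  resample e (fun eta => g eta * h eta) =1 (fun eta => resample e g eta * h eta).
Proof. by move=> h_inv eta; rewrite /resample !h_inv; ring. Qed.

Lemma meanER_resample e g : meanER (resample e g) = meanER g.
Proof.
rewrite /meanER !(sum_env_split _ e); apply: eq_bigr => eta etaT.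
rewrite resample_set /resample -[X in set_edge eta e X]etaT set_edge_id.
pose w := \prod_(e' | e' != e) (if eta e' then p else 1 - p).
have -> : pi_ER p eta = p * w by rewrite /pi_ER (bigD1 e)//= etaT.
have -> : pi_ER p (set_edge eta e false) = (1 - p) * w.
  rewrite /pi_ER (bigD1 e)//= set_edgeE eqxx; congr (_ * _).
  by apply: eq_bigr => e' /negPf; rewrite set_edgeE => ->.
by ring.
Qed.

(** The projection property: [resample e h] does not depend on the edge [e], so it factors out when
    the product is resampled. *)
Lemma meanER_mul_resample e g h :
  meanER (fun eta => g eta * resample e h eta) =
  meanER (fun eta => resample e g eta * resample e h eta).
Proof.
rewrite -(meanER_resample e); apply: eq_meanER => eta.
by rewrite resample_mulr// => eta' b; rewrite resample_set.
Qed.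

Lemma edge_varE e g : edge_var e g =
  meanER (fun eta => g eta ^+ 2) - meanER (fun eta => resample e g eta ^+ 2).
Proof.
transitivity (meanER (fun eta => g eta ^+ 2)
  - 2 * meanER (fun eta => g eta * resample e g eta)
  + meanER (fun eta => resample e g eta ^+ 2)).
  rewrite -meanERZ -meanERB -meanERD; apply: eq_meanER => eta; ring.
rewrite meanER_mul_resample.
rewrite (@eq_meanER (fun eta => _ * _) (fun eta => resample e g eta ^+ 2)).
  by ring.
by move=> eta; rewrite expr2.
Qed.

Lemma edge_var_mul e g :
  meanER (fun eta => g eta * (g eta - resample e g eta)) = edge_var e g.
Proof.
rewrite edge_varE.
rewrite (_ : meanER (fun eta => resample e g eta ^+ 2) =
             meanER (fun eta => g eta * resample e g eta)).
  by rewrite -meanERB; apply: eq_meanER => eta; ring.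
by rewrite meanER_mul_resample; apply: eq_meanER => eta; rewrite expr2.
Qed.

Definition resample_seq s g : env n -> R := foldr resample g s.

Lemma resample_seqB s g h :
  resample_seq s (fun eta => g eta - h eta) =1
  (fun eta => resample_seq s g eta - resample_seq s h eta).
Proof.
elim: s => //= e s IHs eta; rewrite -resampleB.
by congr (resample e _ eta); apply/funext.
Qed.

Lemma resample_resample_seq e s g :
  resample e (resample_seq s g) =1 resample_seq s (resample e g).
Proof.
elim: s => //= e' s IHs eta; rewrite resampleC.
by congr (resample e' _ eta); apply/funext.
Qed.

Lemma resample_seq_contract s g :
  meanER (fun eta => resample_seq s g eta ^+ 2) <= meanER (fun eta => g eta ^+ 2).
Proof.
elim: s => //= e s; apply: le_trans.
by rewrite -subr_ge0 -edge_varE edge_var_ge0.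
Qed.

Lemma resample_seq_set s g e eta b : e \in s ->
  resample_seq s g (set_edge eta e b) = resample_seq s g eta.
Proof.
elim: s eta => //= e' s IHs eta; rewrite in_cons.
have [->|ee'] /= := eqVneq e e'; first by rewrite resample_set.
move=> es; rewrite /resample.
by rewrite !(set_edgeC _ _ _ ee') !IHs.
Qed.

Lemma meanER_resample_seq s g : meanER (resample_seq s g) = meanER g.
Proof. by elim: s => //= e s <-; rewrite meanER_resample. Qed.

(* Resampling the edges one at a time turns [g] into its mean, and by
   commutation each step loses at most the variance of [g] along that edge. *)
Lemma efron_stein g :
  meanER (fun eta => g eta ^+ 2) - meanER g ^+ 2 <= \sum_e edge_var e g.
Proof.
pose loss s := meanER (fun eta => g eta ^+ 2) -
               meanER (fun eta => resample_seq s g eta ^+ 2).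
have loss_le s : loss s <= \sum_(e <- s) edge_var e g.
  elim: s => [|e s IHs]; first by rewrite big_nil /loss subrr.
  rewrite big_cons; suff : edge_var e (resample_seq s g) <= edge_var e g.
    by move: IHs; rewrite edge_varE /loss /=; lra.
  rewrite /edge_var.
  rewrite (@eq_meanER _ (fun eta =>
      resample_seq s (fun eta => g eta - resample e g eta) eta ^+ 2)).
    exact: resample_seq_contract.
  by move=> eta; rewrite resample_seqB resample_resample_seq.
(* Once every edge is resampled the function is invariant under all edge changes, hence constant and
   equal to its mean. *)
have := loss_le (index_enum (edge n)).
rewrite /loss (@eq_meanER (fun eta => resample_seq _ _ _ ^+ 2)
                          (fun=> meanER g ^+ 2)) ?meanER_cst// => eta.
congr (_ ^+ 2); rewrite -(meanER_resample_seq (index_enum (edge n)) g).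
rewrite -(meanER_cst (resample_seq _ _ eta)); apply: eq_meanER => eta'.
apply: set_edge_invariant_cst => e eta1 b.
by rewrite resample_seq_set// mem_index_enum.
Qed.

Lemma meanER_edge e (F : bool -> R) :
  meanER (fun eta => F (eta e)) = p * F true + (1 - p) * F false.
Proof.
rewrite -(meanER_resample e) -[RHS]meanER_cst; apply: eq_meanER => eta.
by rewrite /resample !set_edgeE eqxx.
Qed.

(* Functions not depending on the edge [e] are orthogonal to [eta e - p], so
   [g] may be replaced by [g - resample e g]. *)
Lemma sqr_cov_edge_le e g :
  meanER (fun eta => ((eta e)%:R - p) * g eta) ^+ 2 <= p * edge_var e g.
Proof.
have -> : meanER (fun eta => ((eta e)%:R - p) * g eta) =
    meanER (fun eta => ((eta e)%:R - p) * (g eta - resample e g eta)).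
  transitivity (meanER (fun eta => ((eta e)%:R - p) * g eta) -
      meanER (fun eta => ((eta e)%:R - p) * resample e g eta)).
    rewrite meanER_mul_resample (@eq_meanER (fun eta => resample _ _ _ * _) (fun=> 0)).
      by rewrite meanER_cst subr0.
    by move=> eta; rewrite /resample !set_edgeE eqxx /=; ring.
  by rewrite -meanERB; apply: eq_meanER => eta; ring.
apply: le_trans (cauchy_schwarz_meanER _ _) _.
rewrite ler_wpM2r ?edge_var_ge0// (meanER_edge e (fun b => (b%:R - p) ^+ 2)) /=.
have := p_ge0; have := p_le1; nra.
Qed.

(** The left side is split as [d - c g + c h]: a part [d] on the event that [e] is open, bounded by
    Cauchy-Schwarz with a factor [p] for its probability, and the covariances of [g] and [h] with
    [eta e]. *)
Lemma sqr_diff_mean_le e g h :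
  (p * (meanER g - meanER h)) ^+ 2 <=
  3 * p * (meanER (fun eta => (eta e)%:R * (g eta - h eta) ^+ 2)
           + edge_var e g + edge_var e h).
Proof.
pose c f := meanER (fun eta => ((eta e)%:R - p) * f eta).
pose d := meanER (fun eta => (eta e)%:R * (g eta - h eta)).
have -> : p * (meanER g - meanER h) = d - c g + c h.
  rewrite /d /c mulrBr -!meanERZ -!meanERB -meanERD.
  by apply: eq_meanER => eta; ring.
have d_le : d ^+ 2 <= p * meanER (fun eta => (eta e)%:R * (g eta - h eta) ^+ 2).
  have := cauchy_schwarz_meanER (fun eta => (eta e)%:R)
            (fun eta => (eta e)%:R * (g eta - h eta)).
  rewrite (meanER_edge e (fun b => b%:R ^+ 2)) /= expr1n mulr1 expr0n mulr0 addr0.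
  rewrite (@eq_meanER _ (fun eta => (eta e)%:R * (g eta - h eta))) => [|eta]; last first.
    by case: (eta e); rewrite ?mul1r ?mul0r.
  rewrite (@eq_meanER (fun eta => (_ * _) ^+ 2)
                      (fun eta => (eta e)%:R * (g eta - h eta) ^+ 2)) => [//|eta].
  by case: (eta e); rewrite ?mul1r ?mul0r ?expr0n.
have := sqr_cov_edge_le e g; have := sqr_cov_edge_le e h.
rewrite -!/(c _) => ch cg.
(* The sum of these squares is the gap in [(d - c g + c h) ^+ 2 <= 3 * (d ^+ 2 + c g ^+ 2 + c h ^+
   2)]. *)
have := sqr_ge0 (d + c g); have := sqr_ge0 (d - c h); have := sqr_ge0 (c g + c h).
move: d_le ch cg; set x := meanER _; set y := edge_var e g; set z := edge_var e h.
by rewrite !expr2 => *; nra.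
Qed.

End Environment.

(** * The generator, its Dirichlet form and the Poincare inequality *)

Section Model.
Variables (R : realType) (n : nat) (p mu : R).
Hypotheses (p_gt0 : 0 < p) (p_le1 : p <= 1) (mu_gt0 : 0 < mu) (n_gt1 : (1 < n)%N).
Implicit Types (f g : state n -> R) (x v : 'I_n) (eta : env n) (e : edge n).

Let p_ge0 : 0 <= p. Proof. exact: ltW. Qed.

Lemma is_openC eta x v : is_open eta x v = is_open eta v x.
Proof. by rewrite /is_open finset.setUC. Qed.

Lemma is_open_edge x v : x != v ->
  exists2 e : edge n, val e = [set x; v]%SET &
    forall eta, is_open eta x v = eta e.
Proof.
move=> xv; have card_xv : #|[set x; v]%SET| == 2%N by rewrite cards2 xv.
pose e0 : edge n := exist (fun A : {set 'I_n} => #|A| == 2%N) _ card_xv.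
exists e0 => // eta; apply/existsP/idP => [[e /andP[/eqP eE]]|eta_e].
  by rewrite (_ : e0 = e)//; exact/val_inj.
by exists e0; rewrite eqxx.
Qed.

Lemma generatorE f x eta : generator p mu f (x, eta) =
  \sum_(v | v != x) (n.-1)%:R^-1 *
     ((is_open eta x v)%:R * (f (v, eta) - f (x, eta)))
  + \sum_e mu * (resample p e (fun eta => f (x, eta)) eta - f (x, eta)).
Proof.
rewrite /generator; congr (_ + _); apply: eq_bigr => i _.
  by case: is_open; rewrite ?mul1r// mul0r subrr.
by rewrite /resample; ring.
Qed.

(** The matrix of the generator, read off from indicators, so that the results on matrix
    exponentials apply. *)
Definition gen_kernel (s s' : state n) : R :=
  generator p mu (fun s1 => (s1 == s')%:R) s.

Lemma generator_kernel : generator p mu = kernel_op gen_kernel.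
Proof.
apply/funext => f; apply/funext => -[x eta].
have fE s : f s = \sum_s' (s == s')%:R * f s'.
  rewrite (bigD1 s)//= eqxx mul1r big1 ?addr0// => s' /negPf.
  by rewrite eq_sym => ->; rewrite mul0r.
rewrite /kernel_op /gen_kernel /generator.
under [RHS]eq_bigr do rewrite mulrDl.
rewrite big_split /=; congr (_ + _).
  under [RHS]eq_bigr do rewrite mulr_suml.
  rewrite [RHS]exchange_big; apply: eq_bigr => v _ /=.
  rewrite !fE -sumrB mulr_sumr; apply: eq_bigr => s' _.
  by rewrite -mulrBl mulrA.
under [RHS]eq_bigr do rewrite mulr_suml.
rewrite [RHS]exchange_big; apply: eq_bigr => e _ /=.
rewrite (fE (x, eta)) (fE (x, set_edge _ _ true)) (fE (x, set_edge _ _ false)).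
rewrite -!sumrB !mulr_sumr -big_split mulr_sumr; apply: eq_bigr => s' _ /=.
by ring.
Qed.

Lemma generator_subr_cst f (c : R) s :
  generator p mu (fun s => f s - c) s = generator p mu f s.
Proof.
case: s => x eta; rewrite /generator.
by congr (_ + _); apply: eq_bigr => i _; ring.
Qed.

(** Minimum principle: at a zero of a nonnegative function all increments are nonnegative. On
    indicators it yields the sign of the off-diagonal entries that [semigroup_ge] asks for. *)
Lemma generator_ge0 f s : (forall s, 0 <= f s) -> f s = 0 ->
  0 <= generator p mu f s.
Proof.
case: s => x eta f_ge0 f0; rewrite /generator f0.
apply: addr_ge0; apply: sumr_ge0 => i _.
  by rewrite subr0 mulr_ge0 ?invr_ge0.
by rewrite mulr_ge0 ?(ltW mu_gt0)// !subr0 addr_ge0 ?mulr_ge0// subr_ge0.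
Qed.

(** The position is summed, not averaged: this is [n] times the stationary mean, and the indicator
    of one vertex has mass 1. *)
Definition mean_joint f : R := \sum_x meanER p (fun eta => f (x, eta)).

Lemma mean_jointE f : \sum_(s : state n) pi_ER p s.2 * f s = mean_joint f.
Proof.
rewrite /mean_joint /meanER pair_bigA /=.
by apply: eq_bigr => -[].
Qed.

Lemma sum_offdiag_swap (F : 'I_n -> 'I_n -> R) :
  \sum_x \sum_(v | v != x) F x v = \sum_x \sum_(v | v != x) F v x.
Proof.
rewrite (exchange_big_dep xpredT) //=.
by apply: eq_bigr => x _; apply: eq_bigl => v; rewrite eq_sym.
Qed.

(** Both orders of a pair are counted, so this is twice the walk part of the Dirichlet form. *)
Definition walk_energy f : R :=
  \sum_x \sum_(v | v != x) (n.-1)%:R^-1 *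
    meanER p (fun eta => (is_open eta x v)%:R * (f (v, eta) - f (x, eta)) ^+ 2).

Definition refresh_energy f : R :=
  \sum_x \sum_e edge_var p e (fun eta => f (x, eta)).

Lemma mean_joint_walk f g :
  mean_joint (fun s => g s * generator p mu f s) =
  \sum_x \sum_(v | v != x) (n.-1)%:R^-1 *
    meanER p (fun eta => (is_open eta x v)%:R *
                         (g (x, eta) * (f (v, eta) - f (x, eta))))
  + \sum_x \sum_e mu * meanER p (fun eta => g (x, eta) *
       (resample p e (fun eta => f (x, eta)) eta - f (x, eta))).
Proof.
rewrite /mean_joint -big_split; apply: eq_bigr => x _ /=.
transitivity (meanER p (fun eta =>
    \sum_(v | v != x) (n.-1)%:R^-1 * ((is_open eta x v)%:R *
       (g (x, eta) * (f (v, eta) - f (x, eta))))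
    + \sum_e mu * (g (x, eta) *
       (resample p e (fun eta => f (x, eta)) eta - f (x, eta))))).
  apply: eq_meanER => eta; rewrite -[LHS]/(g (x, eta) * generator p mu f (x, eta)).
  rewrite generatorE mulrDr !mulr_sumr.
  by congr (_ + _); apply: eq_bigr => i _; ring.
rewrite meanERD !meanER_sum; congr (_ + _); apply: eq_bigr => i _;
  exact: meanERZ.
Qed.

(** Openness is symmetric in the endpoints, so exchanging [x] and [v] turns the walk part into
    squares; the refresh part is [edge_var_mul]. *)
Lemma dirichlet_form f :
  2 * mean_joint (fun s => f s * generator p mu f s) =
  - (walk_energy f + 2 * mu * refresh_energy f).
Proof.
rewrite mean_joint_walk opprD mulrDr; congr (_ + _).
  rewrite mulr_natl mulr2n {2}sum_offdiag_swap -big_split /walk_energy -sumrN.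
  apply: eq_bigr => x _ /=; rewrite -big_split -sumrN; apply: eq_bigr => v _ /=.
  rewrite -mulrDr -mulrN; congr (_ * _); rewrite -meanERD -[RHS]mulN1r -meanERZ.
  by apply: eq_meanER => eta; rewrite (is_openC eta v x); ring.
rewrite /refresh_energy -mulrA -mulrN; congr (2 * _).
rewrite mulr_sumr -sumrN; apply: eq_bigr => x _.
rewrite mulr_sumr -sumrN; apply: eq_bigr => e _.
rewrite -mulrN; congr (mu * _).
rewrite -edge_var_mul -[RHS]mulN1r -meanERZ.
by apply: eq_meanER => eta; ring.
Qed.

(** Stationarity: the walk terms cancel under exchange of [x] and [v], and resampling preserves the
    mean. *)
Lemma mean_joint_generator f : mean_joint (generator p mu f) = 0.
Proof.
have := mean_joint_walk f (fun=> 1).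
rewrite (_ : mean_joint _ = mean_joint (generator p mu f)); last first.
  by apply: eq_bigr => x _; apply: eq_meanER => eta; rewrite mul1r.
move=> ->; rewrite [X in _ + X]big1 ?addr0 => [|x _]; last first.
  apply: big1 => e _; rewrite (@eq_meanER _ _ _ _ (fun eta =>
    resample p e (fun eta => f (x, eta)) eta - f (x, eta))) => [|eta].
    by rewrite meanERB meanER_resample// subrr mulr0.
  by rewrite mul1r.
set W := \sum_x _; suff : W + W = 0 by lra.
rewrite {2}/W sum_offdiag_swap -big_split big1// => x _ /=.
rewrite -big_split big1// => v _ /=.
rewrite -mulrDr -meanERD (@eq_meanER _ _ _ _ (fun=> 0)) ?meanER_cst ?mulr0// => eta.
by rewrite (is_openC eta v x); ring.
Qed.

Lemma sum_edge_var_at (V : 'I_n -> edge n -> R) :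
  (forall x e, 0 <= V x e) ->
  \sum_x \sum_(v | v != x) \sum_(e | val e == [set x; v]%SET) V x e <=
  \sum_x \sum_e V x e.
Proof.
move=> V_ge0; apply: ler_sum => x _.
rewrite (exchange_big_dep xpredT) //=; apply: ler_sum => e _.
rewrite sumr_const; set k := #|_|.
suff : (k <= 1)%N by case: k => [|[|]]// _; rewrite mulr0n.
apply/card_le1_eqP => v w /andP[vx /eqP ev] /andP[wx /eqP ew].
have : v \in [set x; w]%SET by rewrite -ew ev !inE eqxx orbT.
by rewrite !inE (negPf vx) => /eqP.
Qed.

Lemma sum_sqr_diff (a : 'I_n -> R) : \sum_x a x = 0 ->
  \sum_x \sum_(v | v != x) (a x - a v) ^+ 2 = 2 * n%:R * \sum_x a x ^+ 2.
Proof.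
move=> a0; transitivity (\sum_x \sum_v (a x - a v) ^+ 2).
  apply: eq_bigr => x _; rewrite [RHS](bigD1 x)//= subrr expr0n add0r.
  by [].
transitivity (\sum_x (n%:R * a x ^+ 2 + \sum_v a v ^+ 2)).
  apply: eq_bigr => x _.
  transitivity (\sum_(v < n) (a x ^+ 2 + a v ^+ 2 - 2 * a x * a v)).
    by apply: eq_bigr => v _; ring.
  rewrite sumrB -mulr_sumr a0 mulr0 subr0 big_split /= sumr_const card_ord.
  by rewrite mulr_natl.
by rewrite big_split /= -mulr_sumr sumr_const card_ord -mulr_natl; ring.
Qed.

(** [sqr_diff_mean_le] is summed over ordered pairs. Centring turns the squared differences into
    [2 * n] times the sum of squares; each influence is met once as [Vs x v] and once as [Vs v x],
    whence the 2 before [refresh_energy]. *)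
Lemma mean_spread_le f : mean_joint f = 0 ->
  2 * n%:R * p * \sum_x meanER p (fun eta => f (x, eta)) ^+ 2 <=
  3 * ((n.-1)%:R * walk_energy f + 2 * refresh_energy f).
Proof.
move=> f0; pose u x eta := f (x, eta); pose a x := meanER p (u x).
pose o x v := meanER p (fun eta => (is_open eta x v)%:R * (u v eta - u x eta) ^+ 2).
pose V x e := edge_var p e (u x).
have V_ge0 x e : 0 <= V x e by exact: edge_var_ge0.
pose Vs x v := \sum_(e | val e == [set x; v]%SET) V x e.
have edge_le x v : v != x -> p * (a x - a v) ^+ 2 <= 3 * (o x v + Vs x v + Vs v x).
  move=> vx; have [e eE openE] : exists2 e : edge n, val e = [set x; v]%SET &
    forall eta, is_open eta x v = eta e by apply: is_open_edge; rewrite eq_sym.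
  have VsE y w : [set y; w]%SET = [set x; v]%SET -> V y e <= Vs y w.
    move=> yw; rewrite /Vs (bigD1 e) /=; last by rewrite eE yw.
    by rewrite lerDl sumr_ge0.
  have := VsE x v erefl; have := VsE v x (finset.setUC _ _).
  have := sqr_diff_mean_le p_ge0 p_le1 e (u x) (u v).
  rewrite (@eq_meanER _ _ _ (fun eta => _ * _ ^+ 2) (fun eta =>
    (is_open eta x v)%:R * (u v eta - u x eta) ^+ 2)) => [|eta]; last first.
    by rewrite openE; ring.
  rewrite -/(o x v) -/(a x) -/(a v) -/(V x e) -/(V v e) exprMn expr2 -mulrA.
  rewrite [3 * p]mulrC -[p * 3 * _]mulrA ler_pM2l//.
  by lra.
have : p * \sum_x \sum_(v | v != x) (a x - a v) ^+ 2 <=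
    3 * (\sum_x \sum_(v | v != x) o x v
         + \sum_x \sum_(v | v != x) Vs x v
         + \sum_x \sum_(v | v != x) Vs v x).
  rewrite -!big_split !mulr_sumr; apply: ler_sum => x _ /=.
  rewrite -!big_split !mulr_sumr; apply: ler_sum => v vx /=.
  exact: edge_le.
rewrite sum_sqr_diff// -(sum_offdiag_swap Vs).
have := sum_edge_var_at V_ge0; rewrite -/(refresh_energy f).
have -> : (n.-1)%:R * walk_energy f = \sum_x \sum_(v | v != x) o x v.
  rewrite /walk_energy mulr_sumr; apply: eq_bigr => x _.
  rewrite mulr_sumr; apply: eq_bigr => v _.
  by rewrite mulVKf// pnatr_eq0 -lt0n -ltnS prednK// ltnW.
rewrite -/(Vs _ _) /a /u => h1 h2.
rewrite (_ : 2 * _ * _ * _ = p * (2 * n%:R *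
  \sum_(i < n) meanER p (fun eta => f (i, eta)) ^+ 2)); last by ring.
apply: le_trans h2 _; rewrite ler_pM2l//.
by move: h1; rewrite /Vs; lra.
Qed.

Definition relaxation_const : R := 1 + 3 / (n%:R * p).

Lemma poincare f : mu * n%:R <= 1 -> mean_joint f = 0 ->
  mean_joint (fun s => f s * generator p mu f s) <=
  - (mu / relaxation_const) * mean_joint (fun s => f s ^+ 2).
Proof.
move=> mun f0.
have np_gt0 : 0 < n%:R * p by rewrite mulr_gt0 ?ltr0n// ltnW.
have C_gt0 : 0 < relaxation_const by rewrite addr_gt0// divr_gt0.
have spread := mean_spread_le f0.
have ES : mean_joint (fun s => f s ^+ 2)
    - \sum_x meanER p (fun eta => f (x, eta)) ^+ 2 <= refresh_energy f.
  rewrite /mean_joint -sumrB; apply: ler_sum => x _.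
  exact: efron_stein.
have := dirichlet_form f.
set A := mean_joint _ in ES *; set B := mean_joint _.
move: spread ES; set U := \sum_x _; set W := walk_energy f.
set D := refresh_energy f => spread ES dir.
have W_ge0 : 0 <= W.
  apply: sumr_ge0 => x _; apply: sumr_ge0 => v _; rewrite mulr_ge0 ?invr_ge0//.
  by apply: meanER_ge0 => // eta; rewrite mulr_ge0 ?sqr_ge0.
have D_ge0 : 0 <= D.
  by apply: sumr_ge0 => x _; apply: sumr_ge0 => e _; exact: edge_var_ge0.
have mun1 : mu * (n.-1)%:R <= 1.
  by apply: le_trans mun; rewrite ler_pM2l// ler_nat leq_pred.
rewrite mulNr lerNr mulrAC ler_pdivrMr//.
have U_le : U <= 3 / (n%:R * p) * ((n.-1)%:R * W / 2 + D).
  rewrite mulrAC ler_pdivlMr//; lra.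
(* Here [mu * n <= 1] absorbs the factor [n.-1] in front of the walk energy. *)
have muU : mu * U <= 3 / (n%:R * p) * (W / 2 + mu * D).
  apply: le_trans (ler_wpM2l (ltW mu_gt0) U_le) _.
  rewrite mulrCA ler_pM2l ?divr_gt0//.
  have : (mu * (n.-1)%:R) * W <= 1 * W by rewrite ler_wpM2r.
  lra.
have : mu * A <= mu * U + mu * D by rewrite -mulrDr ler_pM2l//; lra.
rewrite /relaxation_const.
move: muU; set c := 3 / _ => muU mA.
have c_ge0 : 0 <= c by rewrite divr_ge0// ltW.
have -> : - B = W / 2 + mu * D by lra.
lra.
Qed.

(** The deviation is the inner product of [v 0] and [v t]; Cauchy-Schwarz reduces it to the squared
    norm [phi], which decays by [poincare] and Gronwall. *)
Lemma law_ER_singleton_decay x0 t : mu * n%:R <= 1 -> 0 <= t ->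
  `|law_ER p mu x0 t [set x0]%SET - n%:R^-1| <=
  expR (- (mu / relaxation_const) * t).
Proof.
move=> mun t_ge0; pose gam := - (mu / relaxation_const).
rewrite -/gam.
pose f (s : state n) : R := (s \in [set s | s.1 \in [set x0]]%SET)%:R.
have f_val x eta : f (x, eta) = (x == x0)%:R by rewrite /f !inE.
pose v r s := semigroup (generator p mu) r f s - n%:R^-1.
have dv s (r : R) : is_derive r 1 (v ^~ s) (generator p mu (v r) s).
  rewrite /v generator_subr_cst generator_kernel.
  rewrite -[kernel_op _ _ _]subr0.
  exact: is_deriveB (is_derive_semigroup _ _ _ _) (is_derive_cst _ _ _).
have v0 s : v 0 s = f s - n%:R^-1 by rewrite /v generator_kernel semigroup0.
have n_neq0 : n%:R != 0 :> R by rewrite pnatr_eq0 -lt0n ltnW.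
have v_mean r : mean_joint (v r) = 0.
  pose m r := \sum_(s : state n) pi_ER p s.2 * v r s.
  have dm (r1 : R) : is_derive r1 1 m 0.
    rewrite -(mean_joint_generator (v r1)) -mean_jointE.
    exact: is_derive_sum_fun (fun s => is_derive_scale_fun _ (dv s r1)).
  rewrite -mean_jointE -/(m r) (is_derive_0_is_cst r 0 dm) /m mean_jointE.
  rewrite /mean_joint; under eq_bigr do under eq_fun do rewrite v0 f_val.
  under eq_bigr do rewrite meanER_cst.
  rewrite sumrB sumr_const card_ord -[_^-1 *+ n]mulr_natl mulfV//.
  by rewrite (bigD1 x0)//= eqxx big1 ?addr0 ?subrr// => x /negPf ->.
pose phi r := \sum_(s : state n) pi_ER p s.2 * (v r s * v r s).
pose dphi r := \sum_(s : state n)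
  pi_ER p s.2 * (v r s * generator p mu (v r) s + v r s * generator p mu (v r) s).
have dphiP (r : R) : is_derive r 1 phi (dphi r).
  exact: is_derive_sum_fun
    (fun s => is_derive_scale_fun _ (is_derive_mul_fun (dv s r) (dv s r))).
have dphi_le r : dphi r <= 2 * gam * phi r.
  have -> : dphi r = 2 * mean_joint (fun s => v r s * generator p mu (v r) s).
    by rewrite -mean_jointE mulr_sumr; apply: eq_bigr => s _; ring.
  have -> : phi r = mean_joint (fun s => v r s ^+ 2).
    by rewrite -mean_jointE; apply: eq_bigr => s _; rewrite expr2.
  by rewrite -mulrA ler_pM2l//; exact: poincare mun (v_mean r).
(* As [mean_joint] sums over positions, [phi 0] is [1 - 1 / n]. *)
have phi0_le : phi 0 <= 1.
  rewrite /phi mean_jointE /mean_joint.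
  under eq_bigr do under eq_fun do rewrite v0 f_val.
  under eq_bigr do rewrite meanER_cst.
  rewrite (eq_bigr (fun x => (x == x0)%:R * (1 - 2 * n%:R^-1) + n%:R^-1 ^+ 2)).
    rewrite big_split /= -mulr_suml sumr_const card_ord -[_ ^+ 2 *+ n]mulr_natl.
    rewrite (bigD1 x0)//= eqxx big1 ?addr0 => [|x /negPf ->//].
    rewrite expr2 mulVKf// mul1r; have : 0 <= n%:R^-1 :> R by rewrite invr_ge0.
    by lra.
  by move=> x _; move: n%:R^-1 => c; case: (x == x0) => /=; ring.
have phi0_ge0 : 0 <= phi 0.
  by apply: sumr_ge0 => s _; rewrite mulr_ge0 ?pi_ER_ge0 -?expr2 ?sqr_ge0.
have phi_t := gronwall dphiP dphi_le t_ge0.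
(* The constant in [v 0] contributes nothing because [v t] has mean zero; the indicator selects the
   starting vertex [x0]. *)
have -> : law_ER p mu x0 t [set x0]%SET - n%:R^-1 =
    \sum_(s : state n) pi_ER p s.2 * (v 0 s * v t s).
  rewrite mean_jointE.
  have := v_mean t; rewrite /mean_joint => vt0.
  under [RHS]eq_bigr do under eq_fun do rewrite v0 f_val mulrBl.
  under [RHS]eq_bigr do rewrite meanERB !meanERZ.
  rewrite sumrB -mulr_sumr vt0 mulr0 subr0.
  rewrite (bigD1 x0)//= eqxx mul1r big1 ?addr0 => [|x /negPf ->]; last by rewrite mul0r.
  rewrite /v meanERB meanER_cst//; congr (_ - _).
  by apply: eq_bigr => eta _; rewrite mulrC.
rewrite -(@ler_pXn2r _ 2%N) ?nnegrE ?expR_ge0// real_normK ?num_real//.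
apply: le_trans (cauchy_schwarz_sum _ _ _) _.
  by move=> s; exact: pi_ER_ge0.
have phiE r : \sum_(s : state n) pi_ER p s.2 * v r s ^+ 2 = phi r.
  by apply: eq_bigr => s _; rewrite expr2.
rewrite !phiE [leRHS]expr2 -expRD -mulrDl -[gam + gam]mulr2n -mulr_natl.
apply: le_trans (ler_wpM2l phi0_ge0 phi_t) _.
rewrite mulrA ler_piMl ?expR_ge0//; nra.
Qed.

End Model.

(** * Invariance of the model under relabelling of the vertices *)

Section Symmetry.
Variables (R : realType) (n : nat) (p mu : R) (tau : 'I_n -> 'I_n).
Hypothesis tauK : involutive tau.
Implicit Types (x v : 'I_n) (eta : env n) (e : edge n).

Lemma edge_map_subproof e : #|tau @: val e|%SET == 2%N.
Proof. by rewrite card_imset ?(valP e)//; exact: inv_inj. Qed.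

Definition edge_map e : edge n :=
  exist (fun A : {set 'I_n} => #|A| == 2%N) _ (edge_map_subproof e).

Lemma edge_mapK : involutive edge_map.
Proof.
move=> e; apply: val_inj; rewrite /= -imset_comp -[RHS]imset_id.
by apply: eq_imset => x /=; rewrite tauK.
Qed.

Definition env_map eta : env n := [ffun e => eta (edge_map e)].

Lemma env_mapK : involutive env_map.
Proof. by move=> eta; apply/ffunP => e; rewrite !ffunE edge_mapK. Qed.

Lemma is_open_map eta x v : is_open (env_map eta) (tau x) (tau v) = is_open eta x v.
Proof.
have imE y w : (tau @: [set y; w] = [set tau y; tau w])%SET.
  by rewrite imsetU1 imset_set1.
apply/existsP/existsP => -[e /andP[/eqP eE eta_e]]; exists (edge_map e).
  by rewrite /= eE imE !tauK eqxx; move: eta_e; rewrite ffunE.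
by rewrite /= eE imE eqxx ffunE edge_mapK.
Qed.

Lemma set_edge_map eta e b :
  set_edge (env_map eta) (edge_map e) b = env_map (set_edge eta e b).
Proof.
apply/ffunP => e'; rewrite set_edgeE !ffunE.
by rewrite -(can_eq edge_mapK) edge_mapK.
Qed.

Definition state_map (s : state n) : state n := (tau s.1, env_map s.2).

Lemma generator_map (f : state n -> R) s :
  generator p mu (f \o state_map) s = generator p mu f (state_map s).
Proof.
case: s => x eta; rewrite /generator /=; congr (_ + _).
  rewrite [RHS](reindex_inj (inv_inj tauK)) /=.
  apply: eq_big => [v|v _]; first by rewrite (inj_eq (inv_inj tauK)).
  rewrite /state_map /= is_open_map.
  by case: is_open.
rewrite [RHS](reindex_inj (inv_inj edge_mapK)) /=.
by apply: eq_bigr => e _; rewrite /state_map /= !set_edge_map.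
Qed.

Lemma semigroup_map (f : state n -> R) t s :
  semigroup (generator p mu) t (f \o state_map) s =
  semigroup (generator p mu) t f (state_map s).
Proof.
have iterE k : iter k (generator p mu) (f \o state_map) =
               iter k (generator p mu) f \o state_map.
  elim: k => //= k ->; apply/funext => s1; exact: generator_map.
rewrite /semigroup; congr (limn (series _)).
by apply/funext => k; rewrite iterE.
Qed.

Lemma pi_ER_map eta : pi_ER p (env_map eta) = pi_ER p eta.
Proof.
rewrite [RHS](reindex_inj (inv_inj edge_mapK)).
by apply: eq_bigr => e _; rewrite ffunE.
Qed.

(** The generator commutes with [state_map], and [pi_ER] is invariant under [env_map]. *)
Lemma law_ER_map x0 t (A : {set 'I_n}) :
  law_ER p mu (tau x0) t A = law_ER p mu x0 t (tau @^-1: A)%SET.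
Proof.
rewrite /law_ER [LHS](reindex_inj (inv_inj env_mapK)).
apply: eq_bigr => eta _; apply: (congr2 _ _ (pi_ER_map eta)); rewrite /law.
rewrite -[(tau x0, env_map eta)]/(state_map (x0, eta)) -semigroup_map.
congr (semigroup _ _ _ _); apply/funext => s.
by rewrite /= !inE.
Qed.

End Symmetry.

(** * The law of the walker: exchangeability and the chance of being at the start *)

Section WalkLaw.
Variables (R : realType) (n : nat) (p mu : R).
Hypotheses (p_gt0 : 0 < p) (p_le1 : p <= 1) (mu_gt0 : 0 < mu) (n_gt1 : (1 < n)%N).
Implicit Types (x v : 'I_n) (eta : env n) (e : edge n) (A : {set 'I_n}).

Let p_ge0 : 0 <= p. Proof. exact: ltW. Qed.

Lemma law_ERE x0 t A : law_ER p mu x0 t A =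
  meanER p (fun eta =>
    semigroup (generator p mu) t (fun s => (s.1 \in A)%:R) (x0, eta)).
Proof.
apply: eq_bigr => eta _; rewrite [LHS]mulrC /law.
suff -> : (fun s : state n => (s \in [set s : state n | s.1 \in A]%SET)%:R) =
          (fun s : state n => (s.1 \in A)%:R : R) by [].
by apply/funext => s; rewrite inE.
Qed.

Lemma law_ER_sum x0 t A : 0 <= t ->
  law_ER p mu x0 t A = \sum_(y in A) law_ER p mu x0 t [set y]%SET.
Proof.
move=> t_ge0; rewrite law_ERE.
under [RHS]eq_bigr do rewrite law_ERE.
rewrite -meanER_sum; apply: eq_meanER => eta.
rewrite !generator_kernel -semigroup_sum//.
congr (semigroup _ _ _ _); apply/funext => s.
have [sA|sA] := boolP (s.1 \in A).
  rewrite (bigD1 s.1)//= inE eqxx big1 ?addr0// => y /andP[_ ys].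
  by rewrite inE eq_sym (negPf ys).
rewrite big1// => y yA; rewrite inE; case: eqP => // sy.
by rewrite sy yA in sA.
Qed.

Lemma law_ER_total x0 t : 0 <= t -> \sum_y law_ER p mu x0 t [set y]%SET = 1.
Proof.
move=> t_ge0; transitivity (law_ER p mu x0 t [set: 'I_n]%SET).
  by rewrite law_ER_sum//; apply: eq_bigl => y; rewrite inE.
rewrite law_ERE -[RHS](meanER_cst n p); apply: eq_meanER => eta.
rewrite (_ : (fun _ => _) = fun=> 1); last by apply/funext => s; rewrite inE.
rewrite generator_kernel semigroup_cst// => -[x eta1].
rewrite -generator_kernel /generator.
by rewrite !big1 ?addr0// => i _; rewrite subrr ?mulr0 ?addr0 ?mulr0.
Qed.

(** The transposition of [y] and [z] fixes [x0]. *)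
Lemma law_ER_exchangeable x0 t y z : y != x0 -> z != x0 ->
  law_ER p mu x0 t [set y]%SET = law_ER p mu x0 t [set z]%SET.
Proof.
move=> yx zx; have tK := @tpermK _ y z.
rewrite -{1}(@tpermD _ y z x0) ?[x0 == _]eq_sym//.
rewrite (law_ER_map p mu tK); congr (law_ER _ _ _ _ _).
by apply/setP => v; rewrite !inE -[X in _ == X](tpermR y z) (inj_eq perm_inj).
Qed.

(* By exchangeability every vertex other than [x0] carries the same deviation,
   and the deviations sum to [0]. *)
Lemma law_ER_dev_le x0 t A : 0 <= t ->
  `|law_ER p mu x0 t A - pi_U R A| <= `|law_ER p mu x0 t [set x0]%SET - n%:R^-1|.
Proof.
move=> t_ge0; pose dev y := law_ER p mu x0 t [set y]%SET - n%:R^-1.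
have n1_gt0 : (0 < n.-1)%N by rewrite -ltnS prednK// ltnW.
have card_x0C : #|[set~ x0]%SET| = n.-1 by rewrite cardsC1 card_ord.
have devA B : law_ER p mu x0 t B - pi_U R B = \sum_(y in B) dev y.
  by rewrite law_ER_sum// sumrB sumr_const /pi_U -[_^-1 *+ _]mulr_natl.
have [z zx0] : exists z, z != x0.
  move: n1_gt0; rewrite -card_x0C => /card_gt0P[z].
  by rewrite !inE => zx0; exists z.
have devz y : y != x0 -> dev y = dev z.
  by move=> yx0; rewrite /dev (law_ER_exchangeable t yx0 zx0).
have devx0 : dev x0 = - ((n.-1)%:R * dev z).
  apply/eqP; rewrite -addr_eq0; apply/eqP.
  transitivity (\sum_y dev y).
    rewrite (bigD1 x0)//= (eq_bigr (fun=> dev z)); last by move=> y /devz.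
    rewrite sumr_const mulr_natl; congr (_ + _ *+ _); rewrite -card_x0C.
    by apply: eq_card => y; rewrite !inE.
  rewrite /dev sumrB law_ER_total// sumr_const card_ord -[_^-1 *+ n]mulr_natl.
  by rewrite mulfV ?subrr// pnatr_eq0 -lt0n ltnW.
rewrite devA -/(dev x0) devx0 normrN normrM normr_nat.
have sum_off (B : {set 'I_n}) : x0 \notin B -> \sum_(y in B) dev y = #|B|%:R * dev z.
  move=> xB; rewrite (eq_bigr (fun=> dev z)) => [|y yB].
    by rewrite sumr_const mulr_natl.
  by apply: devz; apply: contraNneq xB => <-.
have card_off (B : {set 'I_n}) : x0 \notin B -> (#|B| <= n.-1)%N.
  move=> xB; rewrite -card_x0C subset_leq_card//; apply/fintype.subsetP => y yB.
  by rewrite !inE; apply: contraNneq xB => <-.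
have [xA|xA] := boolP (x0 \in A); last first.
  by rewrite sum_off// normrM normr_nat ler_wpM2r// ler_nat card_off.
rewrite (big_setD1 x0)//=.
have xAD : x0 \notin (A :\ x0)%SET by rewrite !inE eqxx.
rewrite sum_off// devx0 -mulNr -mulrDl normrM ler_wpM2r//.
have := card_off _ xAD; rewrite -(ler_nat R) => cardA.
by rewrite ler_norml; have := ler0n R #|(A :\ x0)%SET|; lra.
Qed.

Lemma card_edges_at x0 : (#|[set e : edge n | x0 \in val e]%SET| <= n.-1)%N.
Proof.
have <- : #|[set~ x0]%SET| = n.-1 by rewrite cardsC1 card_ord.
rewrite -(card_imset _ val_inj).
apply: leq_trans (leq_imset_card (fun v => [set x0; v]%SET) _).
apply/subset_leq_card/fintype.subsetP => B /imsetP[e]; rewrite inE => xe ->.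
have /cards2P[y [z [yz eE]]] := valP e.
rewrite eE in xe *; case/set2P: xe => ->.
  by apply/imsetP; exists z; rewrite // !inE eq_sym.
by apply/imsetP; exists y; [rewrite !inE | exact: finset.setUC].
Qed.

(* The walker cannot leave [x0] while all the edges at [x0] are closed, and
   each of the at most [n - 1] such edges opens at rate [mu * p]. *)
Lemma law_ER_singleton_ge x0 t : 0 <= t ->
  (1 - p) ^+ n.-1 * expR (- (mu * p * (n.-1)%:R) * t) <=
  law_ER p mu x0 t [set x0]%SET.
Proof.
(* [iso] is the indicator that all edges at [x0] are closed, written as a product so that changing
   one edge affects one factor and [meanER_prod] gives its mean. *)
move=> t_ge0; pose F e b : R := (if x0 \in val e then ~~ b else true)%:R.
pose iso eta := \prod_e F e (eta e).
have F_ge0 e b : 0 <= F e b by rewrite /F.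
have F_le1 e b : F e b <= 1 by rewrite /F; case: ifP => //; case: b.
have iso_ge0 eta : 0 <= iso eta by apply: prodr_ge0.
have iso_le1 eta : iso eta <= 1 by apply: prodr_ile1 => e _; rewrite F_ge0 F_le1.
pose g (s : state n) : R := (s.1 == x0)%:R * iso s.2.
pose m := #|[set e : edge n | x0 \in val e]%SET|.
have mE : m%:R = \sum_(e : edge n) (x0 \in val e)%:R :> R.
  rewrite /m -sum1_card natr_sum big_mkcond /=.
  by apply: eq_bigr => e _; rewrite inE; case: in_mem.
have m_le : m%:R <= (n.-1)%:R :> R by rewrite ler_nat card_edges_at.
(* If an edge at [x0] is closed, resampling loses a proportion [p] of [iso]; if it is open, [iso] is
   zero and cannot decrease. *)
have resample_ge e eta :
    - (p * (x0 \in val e)%:R) * iso eta <= resample p e iso eta - iso eta.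
  pose r := \prod_(e' | e' != e) F e' (eta e').
  have isoE b : iso (set_edge eta e b) = F e b * r.
    rewrite /iso (bigD1 e)//= set_edgeE eqxx; congr (_ * _).
    by apply: eq_bigr => e' /negPf; rewrite set_edgeE => ->.
  have r_ge0 : 0 <= r by apply: prodr_ge0.
  rewrite /resample !isoE -[in iso eta](set_edge_id eta e) isoE /F.
  have pr_ge0 : 0 <= (1 - p) * r by rewrite mulr_ge0// subr_ge0.
  have := p_ge0; case: (x0 \in val e) => /=; last by nra.
  by case: (eta e) => /=; nra.
have gen_ge s : - (mu * p * (n.-1)%:R) * g s <=
    kernel_op (gen_kernel p mu) g s.
  rewrite -generator_kernel; case: s => x eta.
  have [->|xx0] := eqVneq x x0; last first.
    have g0 : g (x, eta) = 0 by rewrite /g /= (negPf xx0) mul0r.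
    rewrite g0 mulr0; apply: generator_ge0 => // s; exact: mulr_ge0.
  (* The jump part vanishes: an open edge at [x0] forces [iso] to be zero. *)
  rewrite generatorE big1 ?add0r => [|v vx0]; last first.
    rewrite /g /= (negPf vx0) mul0r sub0r eqxx mul1r.
    have [e eE ->] : exists2 e : edge n, val e = [set x0; v]%SET &
        forall eta, is_open eta x0 v = eta e by apply: is_open_edge; rewrite eq_sym.
    case eta_e : (eta e); last by rewrite mul0r mulr0.
    by rewrite /iso (bigD1 e)//= /F eE !inE eqxx eta_e /= mul0r oppr0 !mulr0.
  rewrite (_ : g (x0, eta) = iso eta) ?/g /= ?eqxx ?mul1r//.
  apply: (@le_trans _ _ (\sum_(e : edge n) mu * (- (p * (x0 \in val e)%:R) * iso eta))).
    have -> : \sum_(e : edge n) mu * (- (p * (x0 \in val e)%:R) * iso eta) =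
        - (mu * p * m%:R) * iso eta.
      rewrite mE mulr_sumr -sumrN mulr_suml.
      by apply: eq_bigr => e _; ring.
    by rewrite ler_wpM2r// lerN2 ler_wpM2l// mulr_ge0// ltW.
  apply: ler_sum => e _; rewrite ler_pM2l//.
  apply: le_trans (resample_ge e eta) _.
  by rewrite /resample !mul1r.
have sem_ge eta : expR (- (mu * p * (n.-1)%:R) * t) * iso eta <=
    semigroup (generator p mu) t (fun s => (s.1 \in [set x0]%SET)%:R) (x0, eta).
  rewrite generator_kernel; have -> : iso eta = g (x0, eta).
    by rewrite /g eqxx mul1r.
  apply: semigroup_ge => //.
  - move=> s s' ss'; apply: generator_ge0 => //; by rewrite (negPf ss').
  - by move=> s; apply: mulr_ge0.
  - by move=> s; rewrite /g inE ler_piMr.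
rewrite law_ERE; apply: le_trans (ler_meanER p_ge0 p_le1 sem_ge).
rewrite meanERZ mulrC ler_pM2l ?expR_gt0// meanER_prod.
rewrite (bigID (fun e => x0 \in val e)) /= [X in _ * X]big1 ?mulr1; last first.
  by move=> e /negPf xe; rewrite /F xe !mulr1 addrC subrK.
rewrite (eq_bigr (fun=> 1 - p)) => [|e xe]; last first.
  by rewrite /F xe mulr0 add0r mulr1.
rewrite prodr_const; apply: ler_wiXn2l; rewrite ?subr_ge0 ?gerBl//.
apply: leq_trans (card_edges_at x0).
by rewrite cardsE.
Qed.

End WalkLaw.

(** * Choice of the constants and derivation of the two mixing time bounds *)

Theorem theorem1p3 (R : realType) (lambda : R) (lambda_gt0 : 0 < lambda) :
  exists C : R, forall eps : R, 0 < eps -> eps < 1 ->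
  exists N : nat, forall (n : nat) (n_gt0 : (0 < n)%N), (N <= n)%N ->
  let p := lambda / n%:R in
  let vertex1 : 'I_n := Ordinal n_gt0 in
  (eps < Num.min (expR (- (3 * lambda))) 1 ->
   forall mu : R, 0 < mu ->
   ((mu^-1 * (1 / (2 * lambda)) * ln (1 / eps))%:E
      <= tmix_RW p mu vertex1 eps)%E)
  /\
  (eps < 1 / 4 ->
   forall mu : R, 0 < mu -> mu <= 2 / 3 * (1 + lambda)^-1 / n%:R ->
   (tmix_RW p mu vertex1 eps <= (mu^-1 * (C * ln (1 / eps)))%:E)%E).
Proof.
exists (1 + 3 / lambda) => eps eps_gt0 eps_lt1.
pose l := - ln eps; have epsE : eps = expR (- l) by rewrite opprK lnK.
(* The slack that has to cover [1 / n] in the lower bound. It is positive when [l > 3 * lambda],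
   since then [l / 2 > 5 / 4 * lambda]. *)
pose delta := expR (- (5 / 4 * lambda) - l / 2) - eps.
(* The summands ensure [n >= 2], [p <= 1 / 5] and [1 / n <= delta] when [delta] is positive; the
   absolute value covers the other values of [eps]. *)
exists (2 + Num.bound (5 * lambda) + Num.bound `|delta^-1|)%N => n n_gt0 le_Nn p vertex1.
have n_gt1 : (1 < n)%N by apply: leq_trans le_Nn; rewrite -addnA leq_addr.
have nR_gt0 : 0 < n%:R :> R by rewrite ltr0n.
have n_ge5 : 5 * lambda <= n%:R.
  apply: le_trans (ltW (archi_boundP _)) _; first by rewrite mulr_ge0// ltW.
  rewrite ler_nat; apply: leq_trans le_Nn.
  by apply: leq_trans (leq_addr _ _); exact: leq_addl.
have n_ge_delta : `|delta^-1| <= n%:R.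
  apply: le_trans (ltW (archi_boundP _)) _; first exact: normr_ge0.
  by rewrite ler_nat; apply: leq_trans le_Nn; exact: leq_addl.
have np : n%:R * p = lambda by rewrite /p mulrC divfK// gt_eqF.
have p_gt0 : 0 < p by rewrite divr_gt0.
have p_le5 : p <= 1 / 5 by rewrite ler_pdivrMr//; lra.
have p_le1 : p <= 1 by lra.
have lnE : ln (1 / eps) = l by rewrite div1r lnV// posrE.
have l_gt0 : 0 < l by rewrite oppr_gt0 ln_lt0// eps_gt0.
rewrite lnE; split=> [eps_small mu mu_gt0|_ mu mu_gt0 mu_le].
  have l_ge : 3 * lambda < l.
    by move: eps_small; rewrite lt_min epsE ltr_expR ltrN2 => /andP[].
  have delta_gt0 : 0 < delta by rewrite subr_gt0 epsE ltr_expR; lra.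
  pose t := mu^-1 * (1 / (2 * lambda)) * l.
  have t_ge0 : 0 <= t by rewrite !mulr_ge0 ?invr_ge0 ?divr_ge0 ?mulr_ge0// ltW.
  (* The claimed time itself belongs to the set, with the event that the walker is at vertex 1 as
     witness. *)
  rewrite /tmix_RW; apply: ereal_sup_ubound; exists t => //; split => //.
  apply: le_trans (le_bigmax _ _ [set vertex1]%SET).
  apply: le_trans (ler_norm _).
  have := law_ER_singleton_ge p_gt0 p_le1 mu_gt0 vertex1 t_ge0.
  have n1_le : (n.-1)%:R <= n%:R :> R by rewrite ler_nat leq_pred.
  have pow_ge : expR (- (5 / 4 * lambda)) <= (1 - p) ^+ n.-1.
    apply: (@le_trans _ _ (expR (- (5 / 4 * p)) ^+ n.-1)).
      rewrite -expRM_natl ler_expR -np; nra.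
    apply: lerXn2r; rewrite ?nnegrE ?expR_ge0 ?subr_ge0//.
    (* The bound [1 - p >= expR (- (5 / 4 * p))] follows from [(1 - p) * (1 + 5 / 4 * p) >= 1],
       which is where [p <= 1 / 5] enters. *)
    have q_gt0 : 0 < 1 - p by lra.
    rewrite expRN invf_ple ?posrE ?expR_gt0//.
    apply: le_trans (expR_ge1Dx _).
    by rewrite -[leLHS]div1r ler_pdivrMr//; nra.
  have exp_ge : expR (- (l / 2)) <= expR (- (mu * p * (n.-1)%:R) * t).
    rewrite ler_expR [leRHS]mulNr lerN2 /t.
    have -> : mu * p * (n.-1)%:R * (mu^-1 * (1 / (2 * lambda)) * l) =
              (n.-1)%:R * p / lambda * (l / 2).
      by move: (n.-1)%:R (p) (l) => a b c; field; rewrite !gt_eqF.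
    rewrite ler_piMl ?divr_ge0 ?(ltW l_gt0)// ler_pdivrMr// mul1r -np.
    by rewrite ler_pM2r.
  have inv_le : n%:R^-1 <= delta.
    rewrite invf_ple ?posrE//; apply: le_trans n_ge_delta; exact: ler_norm.
  have := ler_pM (expR_ge0 _) (expR_ge0 _) pow_ge exp_ge.
  rewrite -expRD => le1 le2; have := le_trans le1 le2.
  rewrite /pi_U cards1 div1r => le3.
  by move: inv_le; rewrite /delta; lra.
have mun : mu * n%:R <= 1.
  rewrite -ler_pdivlMr// (le_trans mu_le)// ler_pM2r ?invr_gt0//.
  rewrite ler_pdivrMr; lra.
(* Every [t] in the set satisfies [eps <= expR (- mu * t / (1 + 3 / lambda))]; taking logarithms
   bounds [t]. *)
apply: ge_ereal_sup => _ [t [t_ge0 eps_le] <-]; rewrite lee_fin.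
have : eps <= expR (- (mu / relaxation_const n p) * t).
  apply: le_trans eps_le _; apply: bigmax_le => [|A _]; first exact: expR_ge0.
  apply: le_trans (law_ER_dev_le _ _ n_gt1 _ _ t_ge0) _.
  exact: law_ER_singleton_decay.
rewrite /relaxation_const np {1}epsE ler_expR mulNr lerN2 -mulrA => tl.
have C_gt0 : 0 < 1 + 3 / lambda by rewrite addr_gt0// divr_gt0.
by rewrite ler_pdivlMl// -ler_pdivrMl// mulrCA.
Qed.
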